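(* Let $G$ and $H$ be arbitrary connected non-trivial graphs where $H$ is not a complete graph. If $tn(G\circ H)=3\cdot tn(G)$, then $tn(G)=2$.
   Context: All graphs are finite, undirected, without loops or multiple edges; a graph is non-trivial if it has at least two vertices. The lexicographic product $G\circ H$ has vertex set $V(G)\times V(H)$, and $(g_1,h_1)$, $(g_2,h_2)$ are adjacent if either $g_1g_2\in E(G)$ or ($g_1=g_2$ and $h_1h_2\in E(H)$). For distinct non-adjacent vertices $u,v$ of a graph $F$, a tolled walk between $u$ and $v$ is a sequence of vertices $u,w_1,\ldots,w_k,v$ with $k\ge 1$ such that $w_iw_{i+1}\in E(F)$ for all $1\le i<k$, $uw_i\in E(F)$ if and only if $i=1$, and $vw_i\in E(F)$ if and only if $i=k$. If $uv\in E(F)$, the only tolled walk between $u$ and $v$ is $u,v$; the only tolled walk from $v$ to $v$ is $v$ itself. The toll interval $T_F(u,v)$ is the set of all vertices lying on some tolled walk between $u$ and $v$. A set $S\subseteq V(F)$ is a toll set of $F$ if $\bigcup_{u,v\in S}T_F(u,v)=V(F)$. The toll number $tn(F)$ is the minimum size of a toll set of $F$. *)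

(* Defs.v *)
From mathcomp Require Import all_boot.
From mathcomp Require Import boolp.

Set Implicit Arguments.
Unset Strict Implicit.
Unset Printing Implicit Defensive.

Record sgraph := SGraph {
  vertex :> finType;
  edge : rel vertex;
  edge_sym : symmetric edge;
  edge_irrefl : irreflexive edge }.

Definition nontrivial (G : sgraph) : Prop := 2 <= #|G|.

Definition connected (G : sgraph) : Prop :=
  forall x y : G, connect (@edge G) x y.

Definition complete_graph (G : sgraph) : Prop :=
  forall x y : G, x != y -> edge x y.

Section Lexicographic.
Variables G H : sgraph.

Definition lex_edge : rel (G * H) :=
  fun p q => edge p.1 q.1 || ((p.1 == q.1) && edge p.2 q.2).

Lemma lex_edge_sym : symmetric lex_edge.
Proof.
by move=> p q; rewrite /lex_edge edge_sym eq_sym [edge p.2 q.2]edge_sym.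
Qed.

Lemma lex_edge_irrefl : irreflexive lex_edge.
Proof. by move=> p; rewrite /lex_edge !edge_irrefl andbF. Qed.

Definition lex_product : sgraph := SGraph lex_edge_sym lex_edge_irrefl.

End Lexicographic.

Section Toll.
Variable F : sgraph.
Implicit Types (u v x : F) (w p : seq F) (S : {set F}).

(* The walk u, w_1, ..., w_k, v has k = size w, and w_i is [nth u w i.-1]. *)
Inductive tolled_walk u v : seq F -> Prop :=
| TolledRefl : u = v -> tolled_walk u v [:: v]
| TolledEdge : edge u v -> tolled_walk u v [:: u; v]
| TolledNonadj w :
    u <> v -> ~ edge u v ->
    0 < size w ->
    (forall i, i.+1 < size w -> edge (nth u w i) (nth u w i.+1)) ->
    (forall i, i < size w -> (edge u (nth u w i) <-> i = 0)) ->
    (forall i, i < size w -> (edge v (nth u w i) <-> i = (size w).-1)) ->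
    tolled_walk u v (u :: rcons w v).

Definition toll_interval u v : {set F} :=
  [set x | `[< exists2 p, tolled_walk u v p & x \in p >]].

Definition toll_set S : bool :=
  \bigcup_(u in S) \bigcup_(v in S) toll_interval u v == [set: F].

Lemma toll_setT : toll_set [set: F].
Proof.
apply/eqP/setP=> x; rewrite inE; apply/bigcupP; exists x; rewrite ?inE //.
apply/bigcupP; exists x; rewrite ?inE //.
by apply/asboolP; exists [:: x]; [exact: TolledRefl | rewrite inE].
Qed.

Definition tn : nat := #|[arg min_(S < [set: F] | toll_set S) #|S|]|.

Lemma tnP : (exists2 S, toll_set S & #|S| = tn) /\
            (forall S, toll_set S -> tn <= #|S|).
Proof.
rewrite /tn; case: arg_minnP => [|S tS minS]; first exact: toll_setT.
by split=> //; exists S.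
Qed.

End Toll.

(* Main.v *)
Require Import Defs.
From mathcomp Require Import all_boot.
From mathcomp Require Import boolp.
From mathcomp Require Import zify.

Set Implicit Arguments.
Unset Strict Implicit.
Unset Printing Implicit Defensive.

(** Since [tn G >= 2] always holds, the point is to show that [tn G >= 3]
    forces [tn (G o H) < 3 * tn G].

    Fix non-adjacent distinct [h1], [h2] in [H] and a toll set [S] of [G].
    There are two cheap ways to cover a whole fibre [{g} x H] of the product.
    A tolled walk of [G] lifts to the product with any constant second
    coordinate, so the fibre over [g] is covered by [S x {h1}] as soon as [g]
    lies on a tolled walk between members of [S] other than [g]; this handles
    every [g] outside [S].  And [(d, h1)], [(d, h2)] are non-adjacent and have
    the entire fibre over any neighbour [g] of [d] as common neighbours.  Hence
    [S x {h1}] together with [D x {h1, h2}] is a toll set whenever [D] has a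
    neighbour of each member of [S] not covered in the first way
    ([tn_lex_le]).  Picking one neighbour per member of [S] gives the bound
    [3 * |S|], and any coincidence improves it.

    A coincidence always exists among three members [a], [b], [c] of [S].  If
    two are adjacent, or two have a common neighbour, then [D] can be chosen
    to meet [S], or to be smaller.  Otherwise the neighbourhoods of the three
    are disjoint, and a path from one of them, say [c], towards another meets
    one of [N(a)], [N(b)] first; so either [c] reaches [a] avoiding [N(b)], or
    it reaches [b] avoiding [N(a)] ([connect_off_or]).  Applying this to each
    of the three vertices in turn, at least two of the three neighbourhoods
    fail to separate the other two vertices, and such a pair of connections
    glues to a tolled walk through one vertex joining the other two
    ([mem_toll_interval]); the vertex in the middle needs no neighbour in
    [D]. *)

(** * Tolled walks *)

Section TolledWalks.
Variable F : sgraph.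
Implicit Types (a b c u v x y : F) (p q w : seq F) (S : {set F}).

Lemma in_toll_interval u v x :
  reflect (exists2 p, tolled_walk u v p & x \in p) (x \in toll_interval u v).
Proof. by rewrite inE; exact: asboolP. Qed.

Lemma toll_setP S :
  reflect (forall x, exists u v, [/\ u \in S, v \in S & x \in toll_interval u v])
          (toll_set S).
Proof.
apply: (iffP eqP) => [covS x | covS].
  have: x \in [set: F] by rewrite inE.
  by rewrite -covS => /bigcupP[u uS /bigcupP[v vS xT]]; exists u, v.
apply/setP=> x; rewrite inE; have [u [v [uS vS xT]]] := covS x.
by apply/bigcupP; exists u => //; apply/bigcupP; exists v.
Qed.

(** The interior conditions seen from the two ends of the interior sequence:
    this form avoids indices when walks are assembled from pieces. *)
Lemma tolled_walkI u v y z w p q :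
    u <> v -> ~ edge u v -> w = y :: p -> w = rcons q z -> path (@edge F) y p ->
    edge u y -> {in p, forall t, ~~ edge u t} ->
    edge v z -> {in q, forall t, ~~ edge v t} ->
  tolled_walk u v (u :: rcons w v).
Proof.
move=> uv nuv wE wE' pth uy up vz vq; apply: TolledNonadj => //.
- by rewrite wE.
- by apply/(sortedP u); rewrite wE.
- move=> [|i]; rewrite wE //= ltnS => ip; split=> // euv.
  by move: (up _ (mem_nth u ip)); rewrite euv.
- move=> i; rewrite wE' size_rcons ltnS nth_rcons /=.
  case: ltngtP => // iq _; split=> [evi | iE]; last by lia.
  by move: (vq _ (mem_nth u iq)); rewrite evi.
Qed.

Lemma common_neighbor_toll u v x :
  u <> v -> ~ edge u v -> edge u x -> edge v x -> x \in toll_interval u v.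
Proof.
move=> uv nuv ux vx; apply/in_toll_interval; exists (u :: rcons [:: x] v).
  exact: (@tolled_walkI _ _ x x [:: x] [::] [::]).
by rewrite !inE eqxx orbT.
Qed.

(** An endpoint cannot reappear inside: its two walk-neighbours would both be
    adjacent to it, or it would be adjacent to the other endpoint. *)
Lemma tolled_interior_neq u v w :
    ~ edge u v ->
    (forall i, i.+1 < size w -> edge (nth u w i) (nth u w i.+1)) ->
    (forall i, i < size w -> (edge u (nth u w i) <-> i = 0)) ->
    (forall i, i < size w -> (edge v (nth u w i) <-> i = (size w).-1)) ->
  forall i, i < size w -> nth u w i <> u /\ nth u w i <> v.
Proof.
move=> nuv wE uE vE i iw; split=> wi.
  case: i => [|i] in iw wi.
    by have := (uE 0 iw).2 erefl; rewrite wi edge_irrefl.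
  have ei := wE i iw; rewrite wi edge_sym in ei.
  have i0 := (uE i (ltnW iw)).1 ei; rewrite {}i0 {i ei} in iw wi.
  have [w2|w2] := ltnP 2 (size w).
    have := wE 1 w2; rewrite wi => e2.
    by have := (uE 2 w2).1 e2.
  have /(vE 1 iw).2 : 1 = (size w).-1 by lia.
  by rewrite wi edge_sym.
have [i1|i1] := ltnP i.+1 (size w); last first.
  have /(vE i iw).2 : i = (size w).-1 by lia.
  by rewrite wi edge_irrefl.
case: i => [|i] in iw wi i1.
  by have := (uE 0 iw).2 erefl; rewrite wi.
have := wE i iw; rewrite wi edge_sym => /(vE i (ltnW iw)).1; lia.
Qed.

Lemma toll_set_size_gt1 S : nontrivial F -> toll_set S -> 1 < #|S|.
Proof.
move=> ntF /toll_setP covS; rewrite ltnNge; apply/negP => /card_le1_eqP S1.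
have /card_gt1P[x [y [_ _ /eqP[]]]] := ntF.
have [u [v [uS vS /in_toll_interval[p up xp]]]] := covS x.
have [u' [v' [uS' vS' /in_toll_interval[p' up' xp']]]] := covS y.
have endpt u0 v0 p0 x0 : u0 \in S -> v0 \in S -> tolled_walk u0 v0 p0 ->
    x0 \in p0 -> x0 = v0.
  move=> u0S v0S; rewrite (S1 _ _ u0S v0S).
  by case=> [_|/[!edge_irrefl]|w /(_ erefl)] //; rewrite inE => /eqP.
rewrite (endpt _ _ _ _ uS vS up xp) (endpt _ _ _ _ uS' vS' up' xp').
exact: S1.
Qed.

(** * Connections that avoid a neighbourhood *)

(** Deleting only the open neighbourhood of [a] is enough: it leaves [a]
    isolated, so a connection between other vertices avoids [a] as well. *)
Definition off a : rel F :=
  fun x y => [&& edge x y, ~~ edge a x & ~~ edge a y].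

Lemma off_connect_sym a : connect_sym (off a).
Proof.
by apply: sym_connect_sym => x y; rewrite /off edge_sym [~~ _ && _]andbC.
Qed.

(** The first vertex of [N(a)] or [N(b)] on a path from [c] to [b] lies in
    only one of them, so its side is reached without touching the other. *)
Lemma connect_off_or a b c :
    ~~ edge a b -> (forall x, ~~ (edge a x && edge b x)) ->
    ~~ edge a c -> ~~ edge b c -> connect (@edge F) c b ->
  connect (off a) c b \/ connect (off b) c a.
Proof.
move=> nab disj nac nbc /connectP[p pth bE].
elim: p => [|y p IHp] /= in c nac nbc pth bE *; first by left; rewrite bE.
have /andP[cy pthy] := pth.
have [ay|nay] := boolP (edge a y).
  have nby : ~~ edge b y by have := disj y; rewrite ay.
  have nba : ~~ edge b a by rewrite edge_sym.
  right; apply: (@connect_trans _ _ y); apply: connect1; rewrite /off.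
    by rewrite cy nbc nby.
  by rewrite edge_sym ay nby nba.
have [yb|nyb] := boolP (edge b y).
  left; apply: (@connect_trans _ _ y); apply: connect1; rewrite /off.
    by rewrite cy nac nay.
  by rewrite edge_sym yb nay nab.
have [h|h] := IHp y nay nyb pthy bE; [left | right].
  by apply: connect_trans h; apply: connect1; rewrite /off cy nac nay.
by apply: connect_trans h; apply: connect1; rewrite /off cy nbc nyb.
Qed.

(** Stopping a connection to [b] at its first vertex in [N(b)]. *)
Lemma connect_off_first a b c :
    connect (off a) c b -> c != b -> ~~ edge b c ->
  exists q z, [/\ path (@edge F) c (rcons q z), edge b z,
    {in q, forall t, ~~ edge b t} & {in rcons q z, forall t, ~~ edge a t}].
Proof.
move=> /connectP[p pth bE].
elim: p => [|y p IHp] /= in c pth bE *; first by rewrite bE eqxx.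
move=> cb nbc; move: pth => /andP[/and3P[cy nac nay] pthy].
have [yb|nyb] := boolP (edge b y).
  exists [::], y; split=> //=; first by rewrite cy.
  by move=> t; rewrite inE => /eqP->.
have neyb : y != b by apply: contraNneq nbc => <-; rewrite edge_sym.
have [q [z [pq bz bq aq]]] := IHp y pthy bE neyb nyb.
exists (y :: q), z; split=> //=; first by rewrite cy.
  by move=> t; rewrite inE => /predU1P[-> | /bq].
by move=> t; rewrite inE => /predU1P[-> | /aq].
Qed.

(** The two connections, each cut at the first vertex next to its target, glue
    at [c] to a tolled walk. *)
Lemma mem_toll_interval a b c :
    a != b -> c != a -> c != b -> ~~ edge a b -> ~~ edge a c -> ~~ edge b c ->
    connect (off a) c b -> connect (off b) c a ->
  c \in toll_interval a b.
Proof.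
move=> ab ca cb nab nac nbc cob coa.
have [q [z [pq bz bq aq]]] := connect_off_first cob cb nbc.
have [p [y [pp ay ap bp]]] := connect_off_first coa ca nac.
pose w := y :: rcons (rev p) c ++ rcons q z.
apply/in_toll_interval; exists (a :: rcons w b); last first.
  by rewrite inE mem_rcons !inE mem_cat mem_rcons !inE eqxx !orbT.
apply: (@tolled_walkI _ _ y z w _ (y :: rcons (rev p) c ++ q)) => //.
- exact/eqP.
- exact/negP.
- by rewrite /w -rcons_cat.
- rewrite cat_path last_rcons pq andbT.
  have := rev_path (@edge F) c (rcons p y).
  rewrite last_rcons belast_rcons rev_cons => ->.
  by under eq_path do rewrite edge_sym.
- move=> t; rewrite mem_cat mem_rcons inE mem_rev.
  by case/orP=> [/predU1P[-> // | /ap] | /aq].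
- move=> t; rewrite inE mem_cat mem_rcons inE mem_rev.
  case/predU1P=> [->|]; first by apply: bp; rewrite mem_rcons mem_head.
  case/orP=> [/predU1P[-> // | tp] | /bq //].
  by apply: bp; rewrite mem_rcons inE tp orbT.
Qed.

(** Each vertex escapes past at least one of the other two, so at most one of
    the three neighbourhoods separates the other two vertices; the remaining
    two neighbourhoods, say [N(a)] and [N(b)], make [c] a middle vertex. *)
Lemma toll_interval_triple a b c :
    connected F -> a != b -> c != a -> c != b ->
    ~~ edge a b -> ~~ edge a c -> ~~ edge b c ->
    (forall x, ~~ (edge a x && edge b x)) ->
    (forall x, ~~ (edge a x && edge c x)) ->
    (forall x, ~~ (edge b x && edge c x)) ->
  [\/ c \in toll_interval a b, b \in toll_interval a c
    | a \in toll_interval b c].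
Proof.
move=> conn ab ca cb nab nac nbc dab dac dbc.
have [ac bc ba] : [/\ a != c, b != c & b != a].
  by rewrite ![_ == c]eq_sym [b == a]eq_sym.
have [nba nca ncb] : [/\ ~~ edge b a, ~~ edge c a & ~~ edge c b].
  by rewrite ![edge c _]edge_sym [edge b a]edge_sym.
have c_in : connect (off a) b c -> connect (off b) a c -> c \in toll_interval a b.
  by move=> h1 h2; apply: mem_toll_interval; rewrite // off_connect_sym.
have b_in : connect (off a) b c -> connect (off c) a b -> b \in toll_interval a c.
  by move=> h1 h2; apply: mem_toll_interval; rewrite // off_connect_sym.
have a_in : connect (off b) a c -> connect (off c) a b -> a \in toll_interval b c.
  by move=> h1 h2; apply: mem_toll_interval.
have orC : connect (off a) b c \/ connect (off b) a c.
  have := connect_off_or nab dab nac nbc (conn c b).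
  by rewrite ![connect _ c _]off_connect_sym.
have orB : connect (off a) b c \/ connect (off c) a b.
  have := connect_off_or nac dac nab ncb (conn b c).
  by rewrite [connect _ b a]off_connect_sym.
have orA := connect_off_or nbc dbc nba nca (conn a c).
case: orC => h1.
  case: orA => h2; first by constructor 1; exact: c_in.
  by constructor 2; exact: b_in.
case: orB => h2; first by constructor 1; exact: c_in.
by constructor 3; exact: a_in.
Qed.

Lemma connected_neighbor : connected F -> nontrivial F ->
  forall x, exists y, edge x y.
Proof.
move=> conn /card_gt1P[a [b [_ _ ab]]] x.
have [y xy] : exists y, x != y.
  by have [xa|xa] := eqVneq x a; [exists b; rewrite xa | exists a].
have /connectP[[|z p] /= pth yE] := conn x y.
  by rewrite yE eqxx in xy.
by exists z; case/andP: pth.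
Qed.

End TolledWalks.

(** * Toll sets of a lexicographic product *)

Section LexicographicToll.
Variables G H : sgraph.
Implicit Types (S D : {set G}) (u v x : G).

Lemma toll_interval_lift u v x (h k l : H) :
    x \in toll_interval u v -> x != u -> x != v ->
  ((x, h) : lex_product G H) \in
    toll_interval ((u, k) : lex_product G H) ((v, l) : lex_product G H).
Proof.
move=> /in_toll_interval[p up xp] xu xv; case: up xp => [_|_|w].
- by rewrite inE (negPf xv).
- by rewrite !inE (negPf xu) (negPf xv).
move=> uv nuv w0 wE uE vE.
have neq := tolled_interior_neq nuv wE uE vE.
rewrite inE (negPf xu) mem_rcons inE (negPf xv) /= => xw.
pose f y : lex_product G H := (y, h).
have nthf i : i < size w -> nth ((u, k) : lex_product G H) (map f w) i = f (nth u w i).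
  exact: nth_map.
apply/(@in_toll_interval (lex_product G H)); exists ((u, k) :: rcons (map f w) (v, l)); last first.
  rewrite inE mem_rcons inE; apply/orP; right; apply/orP; right.
  exact: (map_f f).
apply: TolledNonadj; rewrite ?size_map //.
- by case.
- by rewrite /= /lex_edge /=; have /eqP/negPf-> := uv; move/negP/negPf: nuv => ->.
- move=> i iw; rewrite !nthf ?(ltnW iw) //.
  by rewrite /= /lex_edge /= wE.
- move=> i iw; rewrite nthf // -uE // /= /lex_edge /=.
  have [/eqP] := neq i iw; rewrite eq_sym => /negPf-> _.
  by rewrite /= orbF.
- move=> i iw; rewrite nthf // -vE // /= /lex_edge /=.
  have [_ /eqP] := neq i iw; rewrite eq_sym => /negPf->.
  by rewrite /= orbF.
Qed.

(** Every fibre is covered either by lifting a tolled walk of [G], or, over a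
    neighbour of [D], as common neighbours of a pair [(d, h1)], [(d, h2)]. *)
Lemma tn_lex_le S D (h1 h2 : H) :
    toll_set S -> h1 != h2 -> ~~ edge h1 h2 ->
    {in S, forall s, (exists2 d, d \in D & edge s d) \/
       exists u v, [/\ u \in S, v \in S, s != u, s != v & s \in toll_interval u v]} ->
  tn (lex_product G H) <= #|S :|: D| + #|D|.
Proof.
move=> /toll_setP covS h12 nh12 covD.
have cov x : (exists2 d, d \in D & edge x d) \/
    exists u v, [/\ u \in S, v \in S, x != u, x != v & x \in toll_interval u v].
  have [/covD // | xS] := boolP (x \in S).
  have [u [v [uS vS xT]]] := covS x; right; exists u, v.
  by split=> //; apply: contraNneq xS => ->.
pose U : {set lex_product G H} := setX (S :|: D) [set h1] :|: setX D [set h2].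
have tU : toll_set U.
  apply/toll_setP => -[x h].
  case: (cov x) => [[d dD xd] | [u [v [uS vS xu xv xT]]]]; last first.
    exists (u, h1), (v, h1); split; last exact: toll_interval_lift.
      by rewrite !inE /= uS eqxx.
    by rewrite !inE /= vS eqxx.
  exists (d, h1), (d, h2); split.
  - by rewrite !inE /= dD eqxx orbT.
  - by rewrite !inE /= dD eqxx !orbT.
  - apply: common_neighbor_toll.
    + by case; apply/eqP.
    + by rewrite /= /lex_edge /= edge_irrefl eqxx; apply/negP.
    + by rewrite /= /lex_edge /= edge_sym xd.
    + by rewrite /= /lex_edge /= edge_sym xd.
apply: leq_trans ((tnP (lex_product G H)).2 U tU) _.
apply: leq_trans (leq_card_setU _ _) _.
by rewrite !cardsX !cards1 !muln1.
Qed.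

End LexicographicToll.

Theorem lemma4p14 (G H : sgraph) :
  connected G -> nontrivial G ->
  connected H -> nontrivial H ->
  ~ complete_graph H ->
  tn (lex_product G H) = 3 * tn G ->
  tn G = 2.
Proof.
move=> conG ntG _ _ ncH tnE.
have [[S tS Sk] _] := tnP G.
have S2 := toll_set_size_gt1 ntG tS.
apply/eqP; rewrite eqn_leq -{2}Sk S2 andbT leqNgt -Sk; apply/negP => S3.
have [h1 [h2 [h12 nh12]]] : exists h1 h2 : H, h1 != h2 /\ ~~ edge h1 h2.
  apply: contrapT => noh; apply: ncH => x y xy.
  by apply: contrapT => /negP nxy; apply: noh; exists x, y.
have [nb nbE] : exists nb : G -> G, forall x, edge x (nb x).
  exists (fun x => xchoose (connected_neighbor conG ntG x)) => x.
  exact: xchooseP.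
pose interior s :=
  exists u v, [/\ u \in S, v \in S, s != u, s != v & s \in toll_interval u v].
(* [E] is the part of [S] handled without the chosen neighbours, at the cost of
   putting [X] into [D]; a single saved vertex is enough. *)
have save (E X : {set G}) :
    E \subset S ->
    {in E, forall s, (exists2 d, d \in X & edge s d) \/ interior s} ->
    #|X| <= #|E| -> #|X| < #|E| \/ (exists2 x, x \in S & x \in X) -> False.
  move=> sES covE leXE ltXE.
  pose D := X :|: nb @: (S :\: E).
  have tnle : tn (lex_product G H) <= #|S :|: D| + #|D|.
    apply: (tn_lex_le tS h12 nh12) => s sS.
    have [sE | sE] := boolP (s \in E).
      case: (covE s sE) => [[d dX sd] | ]; last by right.
      by left; exists d => //; rewrite inE dX.
    left; exists (nb s) => //; rewrite inE; apply/orP; right.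
    by apply: imset_f; rewrite !inE sE.
  have cD : #|D| <= #|X| + (#|S| - #|E|).
    apply: leq_trans (leq_card_setU _ _) _; rewrite leq_add2l.
    by apply: leq_trans (leq_imset_card _ _) _; rewrite cardsDS.
  have cE := subset_leq_card sES.
  have cU := cardsUI S D.
  case: ltXE => [ltXE | [x xS xX]]; first by lia.
  have : 0 < #|S :&: D| by apply/card_gt0P; exists x; rewrite !inE xS xX.
  lia.
have adj a b : a \in S -> b \in S -> ~~ edge a b.
  move=> aS bS; apply/negP => ab; apply: (save [set a] [set b]).
  - by rewrite sub1set.
  - by move=> s; rewrite inE => /eqP->; left; exists b; rewrite ?inE.
  - by rewrite !cards1.
  - by right; exists b; rewrite ?inE.
have far a b : a \in S -> b \in S -> a != b -> forall x, ~~ (edge a x && edge b x).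
  move=> aS bS ab x; apply/negP => /andP[ax bx].
  apply: (save [set a; b] [set x]).
  - by rewrite subUset !sub1set aS bS.
  - by move=> s; rewrite !inE => /orP[] /eqP->; left; exists x; rewrite ?inE.
  - by rewrite cards1 cards2 ab.
  - by left; rewrite cards1 cards2 ab.
have notin s : s \in S -> ~ interior s.
  move=> sS sI; apply: (save [set s] set0).
  - by rewrite sub1set.
  - by move=> t; rewrite inE => /eqP->; right.
  - by rewrite cards0.
  - by left; rewrite cards0 cards1.
have /card_gt2P[a [b [c [[aS bS cS] [ab bc ca]]]]] := S3.
have [cb ac ba] : [/\ c != b, a != c & b != a].
  by rewrite eq_sym bc eq_sym ca eq_sym ab.
have := toll_interval_triple conG ab ca cb (adj a b aS bS) (adj a c aS cS)
  (adj b c bS cS) (far a b aS bS ab) (far a c aS cS ac) (far b c bS cS bc).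
case=> inT.
- by apply: (notin c cS); exists a, b.
- by apply: (notin b bS); exists a, c.
- by apply: (notin a aS); exists b, c.
Qed.
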